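(* Let $1\le p<\infty$, $s>0$, $R>0$, and $a>1+(1-\frac p2)_+$. In the sequence model $Y_\lambda=\theta_\lambda+\varepsilon\xi_\lambda$, $\lambda\in\mathbb N^*=\{1,2,\dots\}$, with constant weights $w_\lambda=1$, consider the collection of models $\mathcal M=\big\{\{1,\dots,k\}:\ 1\le k\le N\big\}$ and the PCO estimator $\tilde\theta=\hat\theta^{(\hat m)}$ with penalty $$\mathrm{pen}(m)=2\varepsilon^p\Big(\frac32\sigma_p^p|m|+\kappa_p2^{\frac{(p-2)_+}2}|m|^{(1-\frac p2)_+}x_m^{\frac p2}\Big),\qquad x_m=a\log|m|.$$ Let $$\mathbb B_p^s(R)=\Big\{\vartheta=(\vartheta_\lambda)_{\lambda\in\mathbb N^*}:\ \sup_{k\in\mathbb N^*}k^s\Big(\sum_{\lambda>k}|\vartheta_\lambda|^p\Big)^{1/p}\le R\Big\}.$$ Then there is a constant $C$, not depending on $\varepsilon$ and $N$, such that, as soon as $N\ge R^p\varepsilon^{-p}$, $$\sup_{\theta\in\mathbb B_p^s(R)}\mathbb E\big[\|\tilde\theta-\theta\|_p^p\big]\le C\,R^{\frac p{1+ps}}\varepsilon^{\frac{p^2s}{1+ps}}.$$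
   Context: Model: $0<\varepsilon\le1$, $\theta=(\theta_\lambda)_{\lambda\in\mathbb N^*}$ is an unknown real sequence, and the $\xi_\lambda$ are i.i.d. centered real random variables with $\mathbb P(|\xi_\lambda|\ge t)\le2e^{-t^2/2}$ for all $t\ge0$; $\sigma_p=(\mathbb E|\xi_\lambda|^p)^{1/p}>0$. $N\ge 1$ is an integer. $\|\vartheta\|_p^p=\sum_{\lambda\ge1}|\vartheta_\lambda|^p$. Estimators: for $m\subset\{1,\dots,N\}$, $\hat\theta^{(m)}=(Y_\lambda\mathbf 1_{\{\lambda\in m\}})_{\lambda\ge1}$; $\hat m$ is a minimizer over $m\in\mathcal M$ of $-\sum_{\lambda\in m}|Y_\lambda|^p+\mathrm{pen}(m)$. $(u)_+=\max(u,0)$. Constant $\kappa_p$: $\kappa_p=c_{2,p}+c_{1,p}\max(1,c_{1,p}/(2\sigma_p^p))$, where $c_{1,p},c_{2,p}>0$ are constants depending only on $p$ such that, for every finite family $(\xi_\lambda)_{\lambda\in\mathcal I}$, $|\mathcal I|=D$, of i.i.d. centered variables satisfying $\mathbb P(|\xi_\lambda|\ge t)\le2e^{-t^2/2}$ for all $t\ge0$, and every $x>0$, $\mathbb P\big(\big|\sum_{\lambda\in\mathcal I}|\xi_\lambda|^p-D\sigma_p^p\big|\ge c_{1,p}\sqrt{Dx}+c_{2,p}D^{(1-p/2)_+}x^{p/2}\big)\le2e^{-x}$ (such constants exist). *)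

(* Defs.v *)
From HB Require Import structures.
From mathcomp Require Import all_boot all_order all_algebra.
From mathcomp Require Import finmap.
From mathcomp Require Import all_classical all_reals all_analysis.
Set Implicit Arguments.
Unset Strict Implicit.
Unset Printing Implicit Defensive.
Import Order.TTheory GRing.Theory Num.Theory.
Import numFieldNormedType.Exports.
Local Open Scope classical_set_scope.
Local Open Scope ring_scope.

(* Sequences indexed by {1, 2, ...} are functions on nat: the value at 0 never
   enters any of the definitions below. *)

Definition mutually_independent (R : realType) (d : measure_display)
    (T : measurableType d) (P : probability T R) (I : choiceType) (A : set I)
    (xi : I -> {RV P >-> R}) : Prop :=
  forall (J : {fset I}) (B : I -> set R),
    [set` J] `<=` A -> (forall i, i \in J -> measurable (B i)) ->
    P (\bigcap_(i in [set` J]) (xi i @^-1` B i)) =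
    (\prod_(i <- enum_fset J) P (xi i @^-1` B i))%E.

Definition identically_distributed (R : realType) (d : measure_display)
    (T : measurableType d) (P : probability T R) (I : choiceType) (A : set I)
    (xi : I -> {RV P >-> R}) : Prop :=
  forall i j, A i -> A j -> forall B, measurable B ->
    distribution P (xi i) B = distribution P (xi j) B.

Definition subgaussian_noise (R : realType) (d : measure_display)
    (T : measurableType d) (P : probability T R) (I : choiceType) (A : set I)
    (xi : I -> {RV P >-> R}) : Prop :=
  [/\ mutually_independent A xi,
      identically_distributed A xi,
      forall i, A i -> ('E_P[xi i] = 0)%E &
      forall i, A i -> forall t : R, 0 <= t ->
        (P [set w | (t <= `|xi i w|)%R] <= (2 * expR (- (t ^+ 2 / 2)))%:E)%E].

Definition sigma (R : realType) (d : measure_display) (T : measurableType d)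
    (P : probability T R) (p : R) (X : {RV P >-> R}) : R :=
  fine ('N[P]_(p%:E)[EFin \o X])%E.

Definition pos_part (R : realType) (u : R) : R := Num.max u 0.

(* The index set is nonempty, as witnessed by i0, which also serves to name the
   common value of the sigma_p of the family. *)
Definition concentration_constants (R : realType) (p c1 c2 : R) : Prop :=
  forall (d : measure_display) (T : measurableType d) (P : probability T R)
    (I : finType) (i0 : I) (xi : I -> {RV P >-> R}),
    subgaussian_noise setT xi ->
    forall x : R, 0 < x ->
      (P [set w |
           (c1 * Num.sqrt (#|I|%:R * x) +
              c2 * #|I|%:R `^ pos_part (1 - p / 2) * x `^ (p / 2)
            <= `| \sum_(i : I) `|xi i w| `^ p
                  - #|I|%:R * sigma p (xi i0) `^ p |)%R ]
       <= (2 * expR (- x))%:E)%E.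

Definition kappa (R : realType) (p c1 c2 sig : R) : R :=
  c2 + c1 * Num.max 1 (c1 / (2 * sig `^ p)).

(* |v|_p^p *)
Definition lp_norm_pow (R : realType) (p : R) (v : nat -> R) : \bar R :=
  (\sum_(1 <= l <oo) (`|v l| `^ p)%:E)%E.

Definition besov_ball (R : realType) (p s r : R) : set (nat -> R) :=
  [set v | (ereal_sup
    [set (k%:R `^ s)%:E * (\sum_(k.+1 <= l <oo) (`|v l| `^ p)%:E) `^ p^-1
      | k in [set k : nat | (1 <= k)%N]] <= r%:E)%E].

Definition observation (R : realType) (d : measure_display)
    (T : measurableType d) (P : probability T R) (xi : nat -> {RV P >-> R})
    (eps : R) (theta : nat -> R) (w : T) : nat -> R :=
  fun l => theta l + eps * xi l w.

Definition projection_estimator (R : realType) (y : nat -> R) (m : {fset nat})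
    : nat -> R :=
  fun l => if l \in m then y l else 0.

Definition nested_models (N : nat) : set {fset nat} :=
  [set [fset l | l in iota 1 k]%fset | k in [set k | (1 <= k <= N)%N]].

Definition pco_weight (R : realType) (a : R) (m : {fset nat}) : R :=
  a * ln (#|` m|%:R).

Definition pco_penalty (R : realType) (p a c1 c2 sig eps : R) (m : {fset nat})
    : R :=
  2 * eps `^ p *
    (3 / 2 * sig `^ p * #|` m|%:R +
     kappa p c1 c2 sig * 2 `^ (pos_part (p - 2) / 2) *
       #|` m|%:R `^ pos_part (1 - p / 2) * pco_weight a m `^ (p / 2)).

Definition pco_criterion (R : realType) (p : R) (pen : {fset nat} -> R)
    (y : nat -> R) (m : {fset nat}) : R :=
  - (\sum_(l <- enum_fset m) `|y l| `^ p) + pen m.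

(* A random model: measurability is with respect to the discrete sigma-algebra
   on the countable type of models. *)
Definition pco_selection (R : realType) (d : measure_display)
    (T : measurableType d) (p : R) (M : set {fset nat}) (pen : {fset nat} -> R)
    (Y : T -> nat -> R) (mhat : T -> {fset nat}) : Prop :=
  (forall m, measurable [set w | mhat w = m]) /\
  (forall w, M (mhat w) /\
     forall m, M m ->
       pco_criterion p pen (Y w) (mhat w) <= pco_criterion p pen (Y w) m).

Definition lp_risk (R : realType) (d : measure_display) (T : measurableType d)
    (P : probability T R) (p : R) (thetat : T -> nat -> R) (theta : nat -> R)
    : \bar R :=
  (\int[P]_w lp_norm_pow p (fun l => thetat w l - theta l)%R)%E.

(* Main.v *)
Require Import Defs.
From HB Require Import structures.
From mathcomp Require Import all_boot all_order all_algebra.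
From mathcomp Require Import finmap.
From mathcomp Require Import all_classical all_reals all_analysis.
From mathcomp Require Import measurable_realfun ring lra.
Set Implicit Arguments.
Unset Strict Implicit.
Unset Printing Implicit Defensive.
Import Order.TTheory GRing.Theory Num.Theory.
Import numFieldNormedType.Exports.
Local Open Scope classical_set_scope.
Local Open Scope ring_scope.

(* Write S_k for the sum of |xi_l|^p over 1 <= l <= k.  If k is the selected
   dimension, the loss is eps^p S_k plus the tail of theta beyond k.  Compare
   with a fixed dimension m.  If k <= m, the selection rule bounds the sum of
   |Y_l|^p over k < l <= m by pen(m), which controls the extra bias.  If k > m,
   it gives pen(k) <= pen(m) + sum of |Y_l|^p over m < l <= k, and the linear
   part 3 eps^p sigma_p^p k of pen(k) absorbs the noise as soon as
   S_k <= (3/2) sigma_p^p k.  By the concentration inequality this fails with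
   probability at most 2 exp(- c k^(1/p)), which is summable in k even against
   powers of k, so the exceptional events cost O(eps^p) in expectation.  Hence
   the risk is at most a constant times eps^p m plus the bias at m, and one
   takes m = min(N, floor(eps^(-p/(1+ps))) + 1). *)

(** * Elementary inequalities, series, integrals and sub-Gaussian moments *)

Lemma le_powR_nneg (R : realType) (q x y : R) :
  0 <= q -> 0 <= x -> x <= y -> x `^ q <= y `^ q.
Proof.
move=> q0 x0 xy; apply: ge0_ler_powR => //; rewrite nnegrE //.
exact: le_trans xy.
Qed.

(* Split on whether [`|y| <= h * `|x|]. *)
Lemma powR_normD_le (R : realType) (h p x y : R) : 0 < h -> 0 <= p ->
  `|x + y| `^ p <= (1 + h) `^ p * `|x| `^ p + (1 + h^-1) `^ p * `|y| `^ p.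
Proof.
move=> h0 p0; have hV0 : 0 < h^-1 by rewrite invr_gt0.
have le0 (u v : R) : 0 <= u `^ p * v `^ p by rewrite mulr_ge0 ?powR_ge0.
have xy := ler_normD x y.
case: (leP `|y| (h * `|x|)) => yx.
  rewrite -[X in X <= _]addr0 lerD // -powRM ?addr_ge0 ?(ltW h0) //.
  by apply: le_powR_nneg => //; rewrite (le_trans xy) // mulrDl mul1r lerD2l.
rewrite -[X in X <= _]add0r lerD // -powRM ?addr_ge0 ?(ltW hV0) //.
apply: le_powR_nneg => //; rewrite (le_trans xy) // mulrDl mul1r addrC lerD2l.
by rewrite -ler_pdivrMl ?invr_gt0 // invrK ltW.
Qed.

(** With y = k^(1/p), exp(c y) = exp(c y / n)^n >= (c y / n)^n, which grows like k^(n/p). The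
    integer [n] is taken above p (q + 2), so that n/p >= q + 2. *)
Lemma stretched_exp_decay (R : realType) (p c q : R) : 0 < p -> 0 < c ->
  exists2 C : R, 0 <= C & forall k : nat, (0 < k)%N ->
    k%:R `^ q * expR (- (c * k%:R `^ p^-1)) <= C / k%:R ^+ 2.
Proof.
move=> p0 c0; set n := (Num.truncn (p * (q + 2))).+1.
have n0 : 0 < n%:R :> R by rewrite ltr0n.
have cn0 : 0 < c / n%:R by rewrite divr_gt0.
have hn : q + 2 <= n%:R / p.
  rewrite ler_pdivlMr // mulrC ltW // /n.
  by apply: real_truncnS_gt; rewrite num_real.
exists ((c / n%:R) ^- n); first by rewrite invr_ge0 exprn_ge0 ?(ltW cn0).
move=> k k0; have kR0 : 0 < k%:R :> R by rewrite ltr0n.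
have k1 : 1 <= k%:R :> R by rewrite ler1n.
set y := k%:R `^ p^-1; have y0 : 0 < y by rewrite powR_gt0.
have eyn : (c / n%:R) ^+ n * k%:R `^ (n%:R / p) <= expR (c * y).
  have -> : c * y = n%:R * (c / n%:R * y).
    by rewrite mulrA mulrCA divff ?mulr1 // gt_eqF.
  rewrite expRM_natl mulrC powRrM powRAC powR_mulrn ?powR_ge0 // -/y -exprMn_comm;
    last by exact: mulrC.
  rewrite mulrC; apply: lerXn2r; rewrite ?nnegrE ?expR_ge0 //.
    by rewrite mulr_ge0 // ltW.
  by apply: le_trans (expR_ge1Dx _); rewrite lerDr.
rewrite expRN -[k%:R ^+ 2]powR_mulrn ?ler0n //.
rewrite ler_pdivrMr ?expR_gt0 // mulrAC ler_pdivlMr ?powR_gt0 //.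
rewrite -powRD; last by rewrite (gt_eqF kR0) implybT.
apply: (@le_trans _ _ (k%:R `^ (n%:R / p))); first exact: ler_powR.
by rewrite ler_pdivlMl ?exprn_gt0.
Qed.

Lemma nneseries_inv_sqr_le (R : realType) (C : R) : 0 <= C ->
  (\sum_(0 <= k <oo) (C / k.+1%:R ^+ 2)%:E <= (2 * C)%:E)%E.
Proof.
move=> C0.
(* The induction closes with the sharper bound 2 - 1/(n+1): for x = n+1, the new term 1/(x+1)^2 is
   at most 1/x - 1/(x+1). *)
have H n : \sum_(0 <= k < n.+1) C / k.+1%:R ^+ 2 <= C * (2 - n.+1%:R^-1).
  elim: n => [|n IH]; first by rewrite big_nat1 expr1n invr1; lra.
  rewrite big_nat_recr //=; apply: (le_trans (lerD IH (lexx _))).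
  rewrite -mulrDr ler_wpM2l //.
  rewrite (_ : n.+2%:R = n.+1%:R + 1 :> R); last by rewrite natr1.
  have := ltr0Sn R n; move: (n.+1%:R : R) => x x0.
  rewrite -subr_ge0.
  have -> : 2 - (x + 1)^-1 - (2 - x^-1 + (x + 1) ^- 2) = x^-1 * (x + 1) ^- 2.
    by field; rewrite !gt_eqF ?addr_gt0.
  by rewrite mulr_ge0 // invr_ge0 ?exprn_ge0 ?addr_ge0 ?(ltW x0).
apply: lime_le.
  by apply: is_cvg_nneseries => k _ _; rewrite lee_fin divr_ge0.
near=> n; rewrite sumEFin lee_fin.
have -> : n = n.-1.+1 by rewrite prednK //; near: n; exists 1%N.
by apply: (le_trans (H _)); rewrite mulrC ler_wpM2r // gerBl invr_ge0.
Unshelve. all: by end_near. Qed.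

(** The integral of a nonnegative function is the supremum of the integrals of the nonnegative
    simple functions below it, and a larger function has more of these. In this form it applies
    directly to the loss of the selected estimator. *)
Lemma le_integral_nneg (R : realType) (d : measure_display)
    (T : measurableType d) (mu : {measure set T -> \bar R})
    (f g : T -> \bar R) :
  (forall x, 0 <= f x)%E -> (forall x, f x <= g x)%E ->
  (\int[mu]_x f x <= \int[mu]_x g x)%E.
Proof.
move=> f0 fg; have g0 x : (0 <= g x)%E := le_trans (f0 x) (fg x).
rewrite !ge0_integralTE //; apply: le_ereal_sup => _ [h hf <-].
by exists h => // x; apply: le_trans (hf x) (fg x).
Qed.

Lemma le_term_nneseries (R : realType) (f : nat -> \bar R) (k : nat) :
  (forall n, 0 <= f n)%E -> (f k <= \sum_(0 <= n <oo) f n)%E.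
Proof.
move=> f0; rewrite (@nneseriesD1 _ f k xpredT) //.
by rewrite leeDl // nneseries_ge0.
Qed.

Lemma measurable_superlevel (R : realType) (d : measure_display)
    (T : measurableType d) (f : T -> R) (c : R) :
  measurable_fun setT f -> measurable [set w | c <= f w].
Proof.
move=> mf; rewrite -[X in measurable X]setTI.
rewrite (_ : [set w | c <= f w] = f @^-1` `[c, +oo[).
  by apply: mf => //; exact: measurable_itv.
by apply/seteqP; split => w /=; rewrite in_itv /= andbT.
Qed.

Lemma integral_scaled_indic (R : realType) (d : measure_display)
    (T : measurableType d) (P : {measure set T -> \bar R}) (c : R)
    (A : set T) :
  0 <= c -> measurable A ->
  (\int[P]_w (c * \1_A w)%:E = c%:E * P A)%E.
Proof.
move=> c0 mA.
transitivity (\int[P]_w (c%:E * (\1_A w)%:E))%E.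
  by apply: eq_integral => w _; rewrite EFinM.
rewrite ge0_integralZl_EFin //.
- by rewrite integral_indic // setIT.
- by apply/measurable_EFinP; exact: measurable_indic.
Qed.

(* [`|X|^q] is at most the sum over [n] of [(n + 1)^q] on the event
   [n <= `|X|]: the term with [n] the integer part of [`|X|] suffices. *)
Lemma subgaussian_moment (R : realType) (q : R) : 0 <= q ->
  exists2 K : R, 0 <= K &
    forall (d : measure_display) (T : measurableType d) (P : probability T R)
      (X : {RV P >-> R}),
      (forall t : R, 0 <= t ->
        (P [set w | (t <= `|X w|)%R] <= (2 * expR (- (t ^+ 2 / 2)))%:E)%E) ->
      (\int[P]_w (`|X w| `^ q)%:E <= K%:E)%E.
Proof.
move=> q0.
have [C C0 HC] := @stretched_exp_decay R 1 2^-1 q ltr01 ltac:(by []).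
have e0 : 0 <= 2 * expR 2^-1 * C :> R by rewrite !mulr_ge0 ?expR_ge0.
exists (2 * (2 * expR 2^-1 * C)); first by rewrite mulr_ge0.
move=> d T P X HX.
pose A n := [set w | n%:R <= `|X w|].
have mA n : measurable (A n).
  by apply: measurable_superlevel; exact: measurableT_comp.
pose f n w := (n.+1%:R `^ q * \1_(A n) w)%:E : \bar R.
have f0 n w : (0 <= f n w)%E by rewrite lee_fin mulr_ge0 ?powR_ge0.
have mf n : measurable_fun setT (f n).
  by apply/measurable_EFinP; apply: measurable_funM.
apply: (@le_trans _ _ (\int[P]_w (\sum_(0 <= n <oo) f n w))%E).
  apply: le_integral_nneg => w; first by rewrite lee_fin powR_ge0.
  set n := Num.truncn `|X w|.
  have /andP[nX Xn] : n%:R <= `|X w| < n.+1%:R by apply: truncn_itv.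
  apply: (le_trans _ (@le_term_nneseries _ (fun n => f n w) n _)) => //.
  rewrite lee_fin indicE mem_set // mulr1.
  by apply: le_powR_nneg => //; exact: ltW.
rewrite integral_nneseries //.
apply: le_trans (nneseries_inv_sqr_le e0).
apply: lee_nneseries => n; first by move=> _ _; exact: integral_ge0.
move=> _; rewrite integral_scaled_indic ?powR_ge0 //.
have := HX n%:R (ler0n _ _); rewrite -/(A n) => Hn.
apply: (@le_trans _ _
  ((n.+1%:R `^ q)%:E * (2 * expR (- (n%:R ^+ 2 / 2)))%:E)%E).
  by rewrite lee_pmul2l // lte_fin powR_gt0.
rewrite -EFinM lee_fin.
(* Since n <= n^2, exp(-n^2/2) <= exp(1/2) exp(-(n+1)/2), the decay treated by [stretched_exp_decay]
   with p = 1 and c = 1/2. *)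
apply: (@le_trans _ _ (n.+1%:R `^ q *
  (2 * (expR 2^-1 * expR (- (2^-1 * n.+1%:R `^ 1^-1)))))).
  rewrite ler_wpM2l ?powR_ge0 // ler_wpM2l // -expRD ler_expR.
  rewrite invr1 powRr1 // -[n.+1%:R]natr1.
  have : (n%:R : R) <= n%:R ^+ 2.
    by rewrite -natrX ler_nat; case: (n) => // m; rewrite expnS leq_pmulr.
  move: (n%:R : R) => x; lra.
rewrite [X in X <= _](_ : _ = 2 * expR 2^-1 *
  (n.+1%:R `^ q * expR (- (2^-1 * n.+1%:R `^ 1^-1)))); last by ring.
by rewrite -[X in _ <= X]mulrA ler_wpM2l ?mulr_ge0 ?expR_ge0 //; exact: HC.
Qed.

(** Serves to pass from noise indexed by {1, 2, ...} to the finite index types of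
    [concentration_constants]. *)
Lemma subgaussian_noise_comp (R : realType) (d : measure_display)
    (T : measurableType d) (P : probability T R) (I J : choiceType)
    (A : set J) (f : I -> J) (xi : J -> {RV P >-> R}) :
  injective f -> (forall i, A (f i)) ->
  subgaussian_noise A xi -> subgaussian_noise setT (fun i => xi (f i)).
Proof.
move=> finj fA [ind idd cen tail]; split => //; last first.
- by move=> i _; exact: tail.
- by move=> i _; exact: cen.
- by move=> i j _ _; exact: idd.
move=> K B _ mB.
(* [B'] moves each set [B i] to the index [f i] without an inverse of [f]: by injectivity a single
   condition remains at [j = f i]. *)
pose B' j := [set x | forall i, i \in K -> f i = j -> B i x].
have B'E i : i \in K -> B' (f i) = B i.
  move=> iK; apply/seteqP; split => x /=; first exact.
  by move=> Bx i' _ /finj ->.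
have := ind [fset f i | i in K]%fset B'.
rewrite big_imfset /=; last by move=> i j _ _; exact: finj.
have -> : \bigcap_(j in [set` [fset f i | i in K]%fset]) (xi j @^-1` B' j) =
  \bigcap_(i in [set` K]) (xi (f i) @^-1` B i).
  apply/seteqP; split => w /= H.
    move=> i /= iK; rewrite -(B'E _ iK); apply: (H (f i)) => /=.
    by apply/imfsetP; exists i.
  by move=> _ /= /imfsetP[i /= iK ->]; rewrite /= (B'E _ iK); exact: (H i iK).
move=> ->.
- rewrite !big_seq; apply: eq_bigr => i iK.
  by rewrite B'E.
- by move=> _ /= /imfsetP[i /= _ ->].
- by move=> _ /imfsetP[i /= iK ->]; rewrite B'E //; exact: mB.
Qed.

(** For p >= 1 the exponent (1 - p/2)_+ is at most 1/2. This serves both the second term of the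
    concentration threshold and the logarithmic term of the penalty. *)
Lemma le_powR_pos_part (R : realType) (p x : R) : 1 <= p -> 1 <= x ->
  x `^ pos_part (1 - p / 2) * x `^ 2^-1 <= x.
Proof.
move=> p1 x1; have x0 : 0 < x := lt_le_trans ltr01 x1.
rewrite -powRD; last by rewrite (gt_eqF x0) implybT.
rewrite -[X in _ <= X](powRr1 (ltW x0)); apply: ler_powR => //.
have : pos_part (1 - p / 2) <= 2^-1 by rewrite /pos_part ge_max; apply/andP; split; lra.
lra.
Qed.

(** * Noise power sums, their deviations and their excess *)

Definition noise_power_sum (R : realType) (d : measure_display)
    (T : measurableType d) (P : probability T R) (q : R)
    (xi : nat -> {RV P >-> R}) (k : nat) (w : T) : R :=
  \sum_(1 <= l < k.+1) `|xi l w| `^ q.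

Definition deviation_event (R : realType) (d : measure_display)
    (T : measurableType d) (P : probability T R) (p : R)
    (xi : nat -> {RV P >-> R}) (k : nat) : set T :=
  [set w | 3 / 2 * sigma p (xi 1%N) `^ p * k%:R <= noise_power_sum p xi k w].

(* Summing [a <= a^2 / M + M] over the [k] terms [a = `|xi l|^p], with
   [M = k^3], bounds the power sum on the deviation event. *)
Definition noise_excess (R : realType) (d : measure_display)
    (T : measurableType d) (P : probability T R) (p : R)
    (xi : nat -> {RV P >-> R}) (k : nat) (w : T) : R :=
  (k%:R ^+ 3)^-1 * noise_power_sum (2 * p) xi k w +
  k%:R ^+ 4 * \1_(deviation_event p xi k) w.

Lemma measurable_noise_power (R : realType) (d : measure_display)
    (T : measurableType d) (P : probability T R) (q : R) (X : {RV P >-> R}) :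
  measurable_fun setT (fun w => `|X w| `^ q).
Proof.
apply: (measurableT_comp (measurable_powR q)).
by apply: measurableT_comp.
Qed.

Lemma measurable_noise_power_sum (R : realType) (d : measure_display)
    (T : measurableType d) (P : probability T R) (q : R)
    (xi : nat -> {RV P >-> R}) (k : nat) :
  measurable_fun setT (noise_power_sum q xi k).
Proof. by apply: measurable_sum => l; exact: measurable_noise_power. Qed.

Lemma noise_power_sum_ge0 (R : realType) (d : measure_display)
    (T : measurableType d) (P : probability T R) (q : R)
    (xi : nat -> {RV P >-> R}) (k : nat) (w : T) :
  0 <= noise_power_sum q xi k w.
Proof. by apply: sumr_ge0 => l _; exact: powR_ge0. Qed.

Lemma measurable_deviation_event (R : realType) (d : measure_display)
    (T : measurableType d) (P : probability T R) (p : R)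
    (xi : nat -> {RV P >-> R}) (k : nat) :
  measurable (deviation_event p xi k).
Proof. exact/measurable_superlevel/measurable_noise_power_sum. Qed.

Lemma noise_excess_ge0 (R : realType) (d : measure_display)
    (T : measurableType d) (P : probability T R) (p : R)
    (xi : nat -> {RV P >-> R}) (k : nat) (w : T) :
  0 <= noise_excess p xi k w.
Proof.
by rewrite addr_ge0 // mulr_ge0 ?invr_ge0 ?exprn_ge0 ?noise_power_sum_ge0.
Qed.

Lemma measurable_noise_excess (R : realType) (d : measure_display)
    (T : measurableType d) (P : probability T R) (p : R)
    (xi : nat -> {RV P >-> R}) (k : nat) :
  measurable_fun setT (noise_excess p xi k).
Proof.
apply: measurable_funD; apply: measurable_funM => //.
  exact: measurable_noise_power_sum.
exact/measurable_indic/measurable_deviation_event.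
Qed.

Lemma noise_power_sum_le_excess (R : realType) (d : measure_display)
    (T : measurableType d) (P : probability T R) (p : R)
    (xi : nat -> {RV P >-> R}) (k : nat) (w : T) : (0 < k)%N ->
  noise_power_sum p xi k w <=
  3 / 2 * sigma p (xi 1%N) `^ p * k%:R + noise_excess p xi k w.
Proof.
move=> k0; have kR0 : 0 < k%:R :> R by rewrite ltr0n.
case: (leP (noise_power_sum p xi k w) (3 / 2 * sigma p (xi 1%N) `^ p * k%:R)).
  by move=> H; rewrite (le_trans H) // lerDl noise_excess_ge0.
move=> /ltW H; rewrite -[X in X <= _]add0r lerD //.
  by rewrite !mulr_ge0 ?powR_ge0.
rewrite /noise_excess indicE mem_set //= mulr1 /noise_power_sum mulr_sumr.
rewrite [X in _ + X](_ : _ = \sum_(1 <= l < k.+1) k%:R ^+ 3); last first.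
  by rewrite sumr_const_nat subSS subn0 -[_ ^+ 3 *+ k]mulr_natr -exprSr.
rewrite -big_split /=; apply: ler_sum => l _.
have -> : `|xi l w| `^ (2 * p) = (`|xi l w| `^ p) ^+ 2.
  by rewrite mulrC powRrM powR_mulrn ?powR_ge0.
have := powR_ge0 `|xi l w| p; move: (`|xi l w| `^ p) => x x0.
have := exprn_gt0 3 kR0; move: (k%:R ^+ 3 : R) => M M0.
case: (leP x M) => xM.
  by rewrite -[X in X <= _]add0r lerD // mulr_ge0 ?invr_ge0 ?sqr_ge0 ?(ltW M0).
rewrite -[X in X <= _]addr0 lerD ?(ltW M0) // ler_pdivlMl // expr2.
by rewrite ler_wpM2r // ltW.
Qed.

(** The concentration inequality is centered at [S * K], and the event is an upward deviation by
    half of that; it therefore suffices to choose x so that the threshold is at most [S / 2 * K]. *)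
Lemma deviation_probability (R : realType) (d : measure_display)
    (T : measurableType d) (P : probability T R) (xi : nat -> {RV P >-> R})
    (p c1 c2 : R) :
  1 <= p -> subgaussian_noise [set l : nat | (1 <= l)%N] xi ->
  0 < sigma p (xi 1%N) -> 0 < c1 -> 0 < c2 ->
  concentration_constants p c1 c2 ->
  exists2 c : R, 0 < c & forall k, (0 < k)%N ->
    (P (deviation_event p xi k) <=
      (2 * expR (- (c * k%:R `^ p^-1)))%:E)%E.
Proof.
move=> p1 hxi hsig hc1 hc2 hc.
have p0 : 0 < p := lt_le_trans ltr01 p1.
set S := sigma p (xi 1%N) `^ p.
have S0 : 0 < S by rewrite powR_gt0.
have c12 : 0 < c1 + c2 by rewrite addr_gt0.
set u := S / (2 * (c1 + c2)).
have u0 : 0 < u by rewrite divr_gt0 // mulr_gt0.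
(* v <= u gives (c1 + c2) v <= S/2, and v <= 1 gives v^p <= v because p >= 1. *)
pose v := Num.min 1 u.
have v0 : 0 < v by rewrite lt_min ltr01.
have v1 : v <= 1 by rewrite ge_min lexx.
have vu : (c1 + c2) * v <= S / 2.
  have : v <= u by rewrite ge_min lexx orbT.
  rewrite /u -(ler_pM2l c12) => /le_trans; apply.
  rewrite [X in X <= _](_ : _ = S / 2) //.
  by field; rewrite ?gt_eqF.
(* The deviation level is [x = v^2 k^(1/p)]: both terms of the threshold are
   then at most [v k] up to their constants. *)
exists (v ^+ 2); first by rewrite exprn_gt0.
case=> // k _; set K : R := k.+1%:R.
have K1 : 1 <= K by rewrite ler1n.
have K0 : 0 < K := lt_le_trans ltr01 K1.
set x := v ^+ 2 * K `^ p^-1.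
have x0 : 0 < x by rewrite mulr_gt0 ?exprn_gt0 ?powR_gt0.
have threshold : c1 * Num.sqrt (K * x) +
    c2 * K `^ pos_part (1 - p / 2) * x `^ (p / 2) <= S / 2 * K.
  apply: (@le_trans _ _ ((c1 + c2) * v * K)); last by rewrite ler_wpM2r // ltW.
  rewrite -(mulrA (c1 + c2)) mulrDl; apply: lerD.
    rewrite ler_wpM2l ?(ltW hc1) //.
    have vK0 : 0 <= v * K by rewrite mulr_ge0 // ltW.
    rewrite -(ger0_norm vK0) -sqrtr_sqr; apply: ler_wsqrtr.
    rewrite exprMn mulrCA ler_wpM2l ?exprn_ge0 ?(ltW v0) // expr2.
    rewrite ler_wpM2l ?(ltW K0) // -[X in _ <= X](powRr1 (ltW K0)).
    by apply: ler_powR => //; rewrite invf_le1.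
  rewrite -mulrA ler_wpM2l ?(ltW hc2) //.
  have -> : x `^ (p / 2) = v `^ p * K `^ 2^-1.
    rewrite powRM ?exprn_ge0 ?powR_ge0 ?(ltW v0) //.
    rewrite -powR_mulrn ?(ltW v0) // -!powRrM.
    by congr (_ `^ _ * _ `^ _); field; rewrite ?gt_eqF.
  rewrite mulrCA; apply: ler_pM.
  - exact: powR_ge0.
  - by rewrite mulr_ge0 ?powR_ge0.
  - by apply: ge1r_powR => //; rewrite v0.
  - exact: le_powR_pos_part.
have mf : measurable_fun setT 
    (fun w => `|\sum_(i < k.+1) `|xi i.+1 w| `^ p - K * S|).
  apply: measurableT_comp => //; apply: measurable_funB => //.
  by apply: measurable_sum => i; exact: measurable_noise_power.
(* The ordinal i stands for the index i + 1, so the witness [ord0] names [xi 1], whose [sigma]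
   enters the deviation event. *)
have hnoise := @subgaussian_noise_comp _ _ _ P 'I_k.+1 nat _
  (fun i => i.+1) xi _ _ hxi.
have := hc d T P 'I_k.+1 ord0 (fun i => xi i.+1) (hnoise _ _) x x0.
rewrite card_ord -/K -/S => H.
apply: le_trans (H _ _); last 2 first.
- by move=> i j [] /ord_inj.
- by [].
apply: le_measure; rewrite ?inE.
- exact: measurable_deviation_event.
- exact: measurable_superlevel.
move=> w; rewrite /deviation_event /noise_power_sum /= -/S -/K.
rewrite big_add1 big_mkord => Hw; apply: (le_trans threshold).
by apply: le_trans (ler_norm _); lra.
Qed.

(** Both parts of the excess cost O(1/k^2) in expectation. The first is at most K k / k^3, with K
    bounding the moment of order 2p; the second is k^4 times the deviation probability, handled by
    [stretched_exp_decay] with q = 4. *)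
Lemma noise_excess_summable (R : realType) (d : measure_display)
    (T : measurableType d) (P : probability T R) (xi : nat -> {RV P >-> R})
    (p c1 c2 : R) :
  1 <= p -> subgaussian_noise [set l : nat | (1 <= l)%N] xi ->
  0 < sigma p (xi 1%N) -> 0 < c1 -> 0 < c2 ->
  concentration_constants p c1 c2 ->
  exists2 G : R, 0 <= G &
    (\sum_(0 <= k <oo) \int[P]_w (noise_excess p xi k.+1 w)%:E <= G%:E)%E.
Proof.
move=> p1 hxi hsig hc1 hc2 hc.
have p0 : 0 < p := lt_le_trans ltr01 p1.
have [c c0 Hc] := deviation_probability p1 hxi hsig hc1 hc2 hc.
have [C C0 HC] := stretched_exp_decay 4 p0 c0.
have [K K0 HK] := @subgaussian_moment R (2 * p) ltac:(by rewrite mulr_ge0 // ltW).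
have KC0 : 0 <= K + 2 * C by rewrite addr_ge0 // mulr_ge0.
exists (2 * (K + 2 * C)); first by rewrite mulr_ge0.
apply: le_trans (nneseries_inv_sqr_le KC0).
apply: lee_nneseries => k.
  by move=> _ _; apply: integral_ge0 => w _; rewrite lee_fin noise_excess_ge0.
move=> _; set k1 : R := k.+1%:R.
have k10 : 0 < k1 by rewrite ltr0n.
have M0 : 0 <= (k1 ^+ 3)^-1 by rewrite invr_ge0 exprn_ge0 // ltW.
have -> : (\int[P]_w (noise_excess p xi k.+1 w)%:E =
    \int[P]_w (((k1 ^+ 3)^-1)%:E * (noise_power_sum (2 * p) xi k.+1 w)%:E
      + (k1 ^+ 4 * \1_(deviation_event p xi k.+1) w)%:E))%E by [].
rewrite ge0_integralD //; last 4 first.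
- by move=> w _; rewrite -EFinM lee_fin mulr_ge0 ?noise_power_sum_ge0.
- apply/measurable_EFinP/measurable_funM => //.
  exact: measurable_noise_power_sum.
- by move=> w _; rewrite lee_fin mulr_ge0 // exprn_ge0 // ltW.
- apply/measurable_EFinP/measurable_funM => //.
  exact/measurable_indic/measurable_deviation_event.
rewrite integral_scaled_indic ?exprn_ge0 ?(ltW k10) //; last first.
  exact: measurable_deviation_event.
rewrite ge0_integralZl_EFin //; last 2 first.
- by move=> w _; rewrite lee_fin noise_power_sum_ge0.
- exact/measurable_EFinP/measurable_noise_power_sum.
have B1 : (\int[P]_w (noise_power_sum (2 * p) xi k.+1 w)%:E <= (K * k1)%:E)%E.
  have -> : (\int[P]_w (noise_power_sum (2 * p) xi k.+1 w)%:E =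
      \int[P]_w \sum_(1 <= l < k.+2) (`|xi l w| `^ (2 * p))%:E)%E.
    by apply: eq_integral => w _; rewrite sumEFin.
  rewrite ge0_integral_sum //; last first.
    by move=> l; apply/measurable_EFinP; exact: measurable_noise_power.
  apply: (@le_trans _ _ (\sum_(1 <= l < k.+2) K%:E)%E).
    rewrite big_seq [X in (_ <= X)%E]big_seq; apply: lee_sum => l.
    rewrite mem_index_iota => /andP[l1 _]; apply: HK.
    by case: hxi => _ _ _; exact.
  by rewrite sumEFin sumr_const_nat subn1 /= -[K *+ _]mulr_natr.
have k40 : 0 <= k1 ^+ 4 by rewrite exprn_ge0 // ltW.
apply: (le_trans (leeD (lee_wpmul2l _ B1) (lee_wpmul2l _ (Hc k.+1 isT)))).
  by rewrite lee_fin.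
  by rewrite lee_fin.
rewrite -!EFinM -EFinD lee_fin (mulrDl K); apply: lerD.
  by rewrite le_eqVlt; apply/orP; left; apply/eqP; field; rewrite gt_eqF.
rewrite mulrCA -[X in _ <= X]mulrA ler_wpM2l //.
by rewrite -powR_mulrn ?(ltW k10) //; exact: HC.
Qed.

(** * Nested models and the order of the penalty *)

Lemma mem_nested_model (k l : nat) :
  (l \in [fset l | l in iota 1 k]%fset) = (0 < l < k.+1)%N.
Proof.
rewrite -[RHS](mem_iota 1 k); apply/imfsetP/idP => [[x /= xk ->] //|lk].
by exists l.
Qed.

Lemma perm_nested_model (k : nat) :
  perm_eq (enum_fset [fset l | l in iota 1 k]%fset) (index_iota 1 k.+1).
Proof.
apply: uniq_perm; rewrite ?fset_uniq ?iota_uniq // => l.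
by rewrite mem_nested_model mem_index_iota.
Qed.

Lemma card_nested_model (k : nat) : #|` [fset l | l in iota 1 k]%fset| = k.
Proof.
by have /perm_size := perm_nested_model k; rewrite size_iota subn1.
Qed.

(** Apply ln y <= y - 1 to y = x^(1/p). The power 1/p is chosen so that (ln k)^(p/2) costs only a
    multiple of k^(1/2). *)
Lemma ln_le_powR (R : realType) (p x : R) : 0 < p -> 0 < x ->
  ln x <= p * x `^ p^-1.
Proof.
move=> p0 x0; rewrite -ler_pdivrMl // -ln_powR.
have y0 : 0 < x `^ p^-1 by rewrite powR_gt0.
have -> : ln (x `^ p^-1) = ln (1 + (x `^ p^-1 - 1)) by congr ln; ring.
by apply: (le_trans (le_ln1Dx _)); lra.
Qed.

Lemma kappa_ge0 (R : realType) (p c1 c2 sig : R) : 0 < c1 -> 0 < c2 ->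
  0 <= kappa p c1 c2 sig.
Proof.
move=> hc1 hc2; rewrite addr_ge0 ?(ltW hc2) // mulr_ge0 ?(ltW hc1) //.
by rewrite le_max ler01.
Qed.

Lemma pco_penalty_ge (R : realType) (p a c1 c2 sig eps : R) (k : nat) :
  0 < c1 -> 0 < c2 ->
  3 * sig `^ p * eps `^ p * k%:R <=
    pco_penalty p a c1 c2 sig eps [fset l | l in iota 1 k]%fset.
Proof.
move=> hc1 hc2; rewrite /pco_penalty card_nested_model mulrDr.
rewrite -[X in X <= _]addr0; apply: lerD.
  by rewrite le_eqVlt; apply/orP; left; apply/eqP; field.
by rewrite !mulr_ge0 ?kappa_ge0 ?powR_ge0.
Qed.

(** The logarithmic weight does not change the order of the penalty: its term is at most a multiple
    of k^((1-p/2)_+) k^(1/2), hence of k. *)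
Lemma pco_penalty_le (R : realType) (p a c1 c2 sig : R) :
  1 <= p -> 0 < a -> 0 < c1 -> 0 < c2 ->
  exists2 C : R, 0 <= C & forall (eps : R) (k : nat), (0 < k)%N ->
    pco_penalty p a c1 c2 sig eps [fset l | l in iota 1 k]%fset
      <= C * eps `^ p * k%:R.
Proof.
move=> p1 a0 hc1 hc2; have p0 : 0 < p := lt_le_trans ltr01 p1.
set B := kappa p c1 c2 sig * 2 `^ (pos_part (p - 2) / 2).
have B0 : 0 <= B by rewrite mulr_ge0 ?kappa_ge0 ?powR_ge0.
exists (2 * (3 / 2 * sig `^ p + B * (a * p) `^ (p / 2))).
  by rewrite mulr_ge0 // addr_ge0 // mulr_ge0 ?powR_ge0.
move=> eps k k0; rewrite /pco_penalty /pco_weight card_nested_model -/B.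
set K : R := k%:R.
have K1 : 1 <= K by rewrite ler1n.
have K0 : 0 < K := lt_le_trans ltr01 K1.
have H : K `^ pos_part (1 - p / 2) * (a * ln K) `^ (p / 2) <=
    (a * p) `^ (p / 2) * K.
  have /ler_wpM2l H : (a * ln K) `^ (p / 2) <= (a * p) `^ (p / 2) * K `^ 2^-1.
    have -> : K `^ 2^-1 = (K `^ p^-1) `^ (p / 2).
      by rewrite -powRrM; congr (_ `^ _); field; rewrite gt_eqF.
    rewrite -powRM ?powR_ge0 ?mulr_ge0 ?(ltW a0) ?(ltW p0) //.
    apply: le_powR_nneg.
    - by rewrite divr_ge0 // ltW.
    - by rewrite mulr_ge0 ?(ltW a0) // ln_ge0.
    - by rewrite -mulrA ler_wpM2l ?(ltW a0) // ln_le_powR.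
  apply: (le_trans (H _ _)); first exact: powR_ge0.
  by rewrite mulrCA ler_wpM2l ?powR_ge0 // le_powR_pos_part.
have -> : 2 * (3 / 2 * sig `^ p + B * (a * p) `^ (p / 2)) * eps `^ p * K =
  2 * eps `^ p * (3 / 2 * sig `^ p * K + B * ((a * p) `^ (p / 2) * K)) by ring.
rewrite ler_wpM2l ?mulr_ge0 ?powR_ge0 // lerD2l -mulrA.
by rewrite ler_wpM2l.
Qed.

(** * The pathwise oracle inequality *)

Lemma sum_powR_noise (R : realType) (p eps : R) (e : nat -> R) (m n : nat) :
  0 <= eps ->
  \sum_(m <= l < n) `|eps * e l| `^ p =
    eps `^ p * \sum_(m <= l < n) `|e l| `^ p.
Proof.
move=> eps0; rewrite mulr_sumr; apply: eq_bigr => l _.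
by rewrite normrM powRM // ger0_norm.
Qed.

Lemma lp_loss_split (R : realType) (p eps : R) (theta e : nat -> R) (k : nat) :
  0 < p -> 0 <= eps ->
  lp_norm_pow p (fun l => projection_estimator (fun l => theta l + eps * e l)
      [fset l | l in iota 1 k]%fset l - theta l) =
  ((eps `^ p * \sum_(1 <= l < k.+1) `|e l| `^ p)%:E +
   \sum_(k.+1 <= l <oo) (`|theta l| `^ p)%:E)%E.
Proof.
move=> p0 eps0; rewrite /lp_norm_pow (nneseries_split 1 k); last first.
  by move=> l _; rewrite lee_fin powR_ge0.
rewrite add1n; congr (_ + _)%E.
  rewrite -sum_powR_noise // -sumEFin; apply: eq_big_nat => l /andP[l1 lk].
  rewrite /projection_estimator mem_nested_model l1 lk /=.
  by rewrite addrC addKr.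
apply: congr_lim; apply/funext => n; apply: eq_big_nat => l /andP[lk _].
by rewrite /projection_estimator mem_nested_model ltnS (leqNgt l k) lk andbF sub0r normrN.
Qed.

(* [(1 + h)^p = 3 / 2] for [h = (3 / 2)^(1/p) - 1]. *)
Definition oracle_constant (R : realType) (p Cp : R) : R :=
  2 * Cp + 2 * (1 + ((3 / 2) `^ p^-1 - 1)^-1) `^ p + 5
    + 2 `^ p * Cp + 2 `^ p.

(** Purely deterministic: [e] is one realization of the noise, [g] bounds the excess of its power
    sum at [k], and [b] bounds the bias at [m]. The selected [k] enters the final bound only through
    [g]. *)
Lemma pco_oracle_inequality (R : realType) (p eps S Cp b g penk penm : R)
    (theta e : nat -> R) (k m : nat) :
  0 < p -> 0 < eps -> 0 < S -> 0 <= Cp -> 0 <= b -> 0 <= g ->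
  let y l := theta l + eps * e l in
  - (\sum_(1 <= l < k.+1) `|y l| `^ p) + penk <=
    - (\sum_(1 <= l < m.+1) `|y l| `^ p) + penm ->
  3 * S * eps `^ p * k%:R <= penk ->
  penm <= Cp * eps `^ p * m%:R ->
  \sum_(1 <= l < k.+1) `|e l| `^ p <= 3 / 2 * S * k%:R + g ->
  (\sum_(m.+1 <= l <oo) (`|theta l| `^ p)%:E <= b%:E)%E ->
  ((eps `^ p * \sum_(1 <= l < k.+1) `|e l| `^ p)%:E +
    \sum_(k.+1 <= l <oo) (`|theta l| `^ p)%:E <=
  (oracle_constant p Cp *
    (eps `^ p * m%:R + b + eps `^ p * \sum_(1 <= l < m.+1) `|e l| `^ p
     + eps `^ p * g))%:E)%E.
Proof.
move=> p0 eps0 S0 Cp0 b0 g0 y crit Hpenk Hpenm Hk Hm.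
set A := oracle_constant p Cp.
have eps0' := ltW eps0.
have t0 l : (0 <= (`|theta l| `^ p)%:E)%E by rewrite lee_fin powR_ge0.
set h := (3 / 2) `^ p^-1 - 1 : R.
have hE : (1 + h) `^ p = 3 / 2.
  by rewrite /h addrC subrK -powRrM mulVf ?gt_eqF // powRr1.
have h0 : 0 < h.
  have := @gt0_ltr_powR R p^-1 _ 1 (3 / 2).
  rewrite powR1 subr_gt0 !nnegrE invr_gt0; apply => //; lra.
set Ch := (1 + h^-1) `^ p.
have AE : A = 2 * Cp + 2 * Ch + 5 + 2 `^ p * Cp + 2 `^ p by [].
set E := eps `^ p in crit Hpenk Hpenm *.
have E0 : 0 < E by rewrite powR_gt0.
have Ch0 : 0 <= Ch by rewrite powR_ge0.
have Q0 : 0 <= 2 `^ p :> R by rewrite powR_ge0.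
(* The first three bounds are the coefficients arising when m < k, the last three those arising when
   k <= m. *)
have [[A2C ACh A4] [A1 AQC AQ]] :
    [/\ 2 * Cp <= A, 2 * Ch + 1 <= A & 4 <= A] /\
    [/\ 1 <= A, 2 `^ p * Cp <= A & 1 + 2 `^ p <= A].
  rewrite AE; have QC0 := mulr_ge0 Q0 Cp0.
  move: QC0 Cp0 Ch0 Q0; clear => QC0 Cp0 Ch0 Q0.
  by split; split; lra.
have A0 : 0 <= A := le_trans ler01 A1.
have s0 (f : nat -> R) i j : 0 <= \sum_(i <= l < j) `|f l| `^ p.
  by apply: sumr_ge0 => l _; rewrite powR_ge0.
have [mk|km] := ltnP m k.
(* Write F1 and F2 for eps^p times the noise sums up to m and over m < l <= k. Doubling [Hk] gives 2
   (F1 + F2) <= penk + 2 E g, while the selection rule and [powR_normD_le] give penk <= penm + (3/2)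
   F2 + Ch b. As 3/2 < 2, F2 is absorbed on the left. *)
- have tailm := Hm.
  rewrite (nneseries_split m.+1 (k - m)) // addSn subnKC ?(ltnW mk) // in tailm.
  have tk0 : (0 <= \sum_(k.+1 <= l <oo) (`|theta l| `^ p)%:E)%E.
    exact: nneseries_ge0.
  have Hsum : \sum_(m.+1 <= l < k.+1) `|theta l| `^ p <= b.
    by rewrite -lee_fin -sumEFin; apply: le_trans tailm; rewrite leeDl.
  have Htail : (\sum_(k.+1 <= l <oo) (`|theta l| `^ p)%:E <= b%:E)%E.
    by apply: le_trans tailm; rewrite leeDr // sumEFin lee_fin.
  apply: (le_trans (leeD (lexx _) Htail)); rewrite -EFinD lee_fin.
  have Hy : \sum_(m.+1 <= l < k.+1) `|y l| `^ p <=
      3 / 2 * (E * \sum_(m.+1 <= l < k.+1) `|e l| `^ p) + Ch * b.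
    apply: (@le_trans _ _ (\sum_(m.+1 <= l < k.+1)
        (3 / 2 * `|eps * e l| `^ p + Ch * `|theta l| `^ p))).
      apply: ler_sum => l _; rewrite -hE /y addrC; exact: powR_normD_le (ltW p0).
    rewrite big_split /= -!mulr_sumr sum_powR_noise //.
    by rewrite lerD2l ler_wpM2l.
  have V0 : 0 <= E * m%:R by rewrite mulr_ge0 // ltW.
  have F0 : 0 <= E * \sum_(1 <= l < m.+1) `|e l| `^ p by rewrite mulr_ge0 // ltW.
  have G0 : 0 <= E * g by rewrite mulr_ge0 // ltW.
  have AV : 2 * (Cp * (E * m%:R)) <= A * (E * m%:R).
    by rewrite mulrA ler_wpM2r.
  have Ab : (2 * Ch + 1) * b <= A * b.
    by rewrite ler_wpM2r.
  have AG : 4 * (E * g) <= A * (E * g).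
    by rewrite ler_wpM2r.
  have AF : 0 <= A * (E * \sum_(1 <= l < m.+1) `|e l| `^ p).
    by rewrite mulr_ge0.
  have EHk := ler_wpM2l (ltW E0) Hk.
  move: crit EHk.
  rewrite !(@big_cat_nat _ _ _ m.+1 1 k.+1) //= ?ltnS ?(ltnW mk) //.
  rewrite 4!mulrDr => crit EHk; lra.
- move: Hk => _.
  rewrite (nneseries_split k.+1 (m - k)) // addSn subnKC // sumEFin addeA -EFinD.
  apply: (le_trans (leeD (lexx _) Hm)); rewrite -EFinD lee_fin.
  (* Here the bias between k and m is recovered from theta = y - eps e, taking h = 1 in
     [powR_normD_le]; the selection rule then bounds the sum of |y l|^p by penm. *)
  have Hy : \sum_(k.+1 <= l < m.+1) `|theta l| `^ p <=
      2 `^ p * \sum_(k.+1 <= l < m.+1) `|y l| `^ p +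
      2 `^ p * (E * \sum_(k.+1 <= l < m.+1) `|e l| `^ p).
    rewrite -(@sum_powR_noise _ p eps e _ _ eps0') !mulr_sumr -big_split /=.
    apply: ler_sum => l _.
    have := @powR_normD_le R 1 p (y l) (- (eps * e l)) ltr01 (ltW p0).
    rewrite invr1 normrN /y addrK; exact.
  have V0 : 0 <= E * m%:R by rewrite mulr_ge0 // ltW.
  have G0 : 0 <= E * g by rewrite mulr_ge0 // ltW.
  have F10 : 0 <= E * \sum_(1 <= l < k.+1) `|e l| `^ p by rewrite mulr_ge0 // ltW.
  have F20 : 0 <= E * \sum_(k.+1 <= l < m.+1) `|e l| `^ p by rewrite mulr_ge0 // ltW.
  have AV : 2 `^ p * (Cp * (E * m%:R)) <= A * (E * m%:R).
    by rewrite mulrA ler_wpM2r.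
  have Ab : b <= A * b.
    by rewrite -[X in X <= _]mul1r ler_wpM2r.
  have AG : 0 <= A * (E * g).
    by rewrite mulr_ge0.
  have AF1 : (1 + 2 `^ p) * (E * \sum_(1 <= l < k.+1) `|e l| `^ p) <=
      A * (E * \sum_(1 <= l < k.+1) `|e l| `^ p).
    by rewrite ler_wpM2r.
  have AF2 : (1 + 2 `^ p) * (E * \sum_(k.+1 <= l < m.+1) `|e l| `^ p) <=
      A * (E * \sum_(k.+1 <= l < m.+1) `|e l| `^ p).
    by rewrite ler_wpM2r.
  have QF1 := mulr_ge0 Q0 F10; have QF2 := mulr_ge0 Q0 F20.
  have penk0 : 0 <= penk.
    by apply: le_trans Hpenk; rewrite !mulr_ge0 // ltW.
  have Hy2 : \sum_(k.+1 <= l < m.+1) `|y l| `^ p <= Cp * (E * m%:R).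
    move: crit; rewrite (@big_cat_nat _ _ _ k.+1 1 m.+1) //= ?ltnS //; lra.
  have QHy2 := ler_wpM2l Q0 Hy2.
  rewrite (@big_cat_nat _ _ _ k.+1 1 m.+1) //= ?ltnS //.
  lra.
Qed.

(** * Expected risk and the rate over the ball *)

Lemma besov_ball_tail (R : realType) (p s r : R) (theta : nat -> R) (m : nat) :
  0 < p -> 0 < r -> (0 < m)%N -> besov_ball p s r theta ->
  (\sum_(m.+1 <= l <oo) (`|theta l| `^ p)%:E <=
    (r `^ p * m%:R `^ (- (p * s)))%:E)%E.
Proof.
move=> p0 r0 m0 Hb; set x := (\sum_(m.+1 <= l <oo) _)%E.
have x0 : (0 <= x)%E by apply: nneseries_ge0 => l _ _; rewrite lee_fin powR_ge0.
have mR0 : 0 < m%:R :> R by rewrite ltr0n.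
have H : ((m%:R `^ s)%:E * x `^ p^-1 <= r%:E)%E.
  by apply: le_trans Hb; apply: ereal_sup_ubound; exists m.
rewrite muleC -lee_pdivlMr ?powR_gt0 // -EFinM in H.
have -> : x = ((x `^ p^-1) `^ p)%E by rewrite -poweRrM mulVf ?gt_eqF // poweRe1.
have -> : r `^ p * m%:R `^ (- (p * s)) = (r / m%:R `^ s) `^ p.
  rewrite powRM ?(ltW r0) ?invr_ge0 ?powR_ge0 //; congr (_ * _).
  by rewrite -powRN -powRrM mulNr mulrC.
rewrite -poweR_EFin; apply: gt0_ler_poweR => //.
- exact: ltW.
- by rewrite in_itv /= poweR_ge0 leey.
- by rewrite in_itv /= leey andbT lee_fin mulr_ge0 ?invr_ge0 ?powR_ge0 ?(ltW r0).
Qed.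

(* The index of the selected model is random, so the excess at that index is
   bounded by the sum of the excesses at all indices. *)
Lemma pco_risk_le (R : realType) (d : measure_display)
    (T : measurableType d) (P : probability T R) (xi : nat -> {RV P >-> R})
    (p a c1 c2 : R) :
  1 <= p -> 0 < a ->
  subgaussian_noise [set l : nat | (1 <= l)%N] xi ->
  0 < sigma p (xi 1%N) -> 0 < c1 -> 0 < c2 ->
  concentration_constants p c1 c2 ->
  exists2 C : R, 0 <= C & forall (eps : R) (N m : nat) (theta : nat -> R)
      (mhat : T -> {fset nat}) (b : R),
    0 < eps -> (1 <= m <= N)%N -> 0 <= b ->
    pco_selection p (nested_models N)
      (pco_penalty p a c1 c2 (sigma p (xi 1%N)) eps)
      (observation xi eps theta) mhat ->
    (\sum_(m.+1 <= l <oo) (`|theta l| `^ p)%:E <= b%:E)%E ->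
    (lp_risk P p (fun w => projection_estimator (observation xi eps theta w)
       (mhat w)) theta <= (C * (eps `^ p * m%:R + b))%:E)%E.
Proof.
move=> p1 a0 hxi hsig hc1 hc2 hc; have p0 : 0 < p := lt_le_trans ltr01 p1.
have [G G0 HG] := noise_excess_summable p1 hxi hsig hc1 hc2 hc.
have [K K0 HK] := @subgaussian_moment R p (ltW p0).
have [Cp Cp0 HCp] := pco_penalty_le (sigma p (xi 1%N)) p1 a0 hc1 hc2.
set A := oracle_constant p Cp.
have A0 : 0 <= A.
  by rewrite /A /oracle_constant !addr_ge0 ?mulr_ge0 ?powR_ge0.
(* [K] pays for the expected noise up to m, [G] for the summed excesses. *)
exists (A * (1 + K + G)); first by rewrite mulr_ge0 // !addr_ge0.
move=> eps N m theta mhat b eps0 /andP[m1 mN] b0 [_ Hsel] Hb.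
set E := eps `^ p.
have E0 : 0 <= E by rewrite powR_ge0.
have AE0 : 0 <= A * E by rewrite mulr_ge0.
have V0 : 0 <= A * (E * m%:R + b) by rewrite mulr_ge0 // addr_ge0 // mulr_ge0.
pose f1 : T -> \bar R := cst (A * (E * m%:R + b))%:E.
pose f2 w : \bar R := ((A * E)%:E * (noise_power_sum p xi m w)%:E)%E.
pose g k w : \bar R := ((A * E)%:E * (noise_excess p xi k.+1 w)%:E)%E.
pose f3 w : \bar R := (\sum_(0 <= k <oo) g k w)%E.
have f20 w : (0 <= f2 w)%E by rewrite /f2 -EFinM lee_fin mulr_ge0 ?noise_power_sum_ge0.
have g0 k w : (0 <= g k w)%E by rewrite /g -EFinM lee_fin mulr_ge0 ?noise_excess_ge0.
have f30 w : (0 <= f3 w)%E by exact: nneseries_ge0.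
have mS : measurable_fun setT (fun w => (noise_power_sum p xi m w)%:E).
  exact/measurable_EFinP/measurable_noise_power_sum.
have mX k : measurable_fun setT (fun w => (noise_excess p xi k.+1 w)%:E).
  exact/measurable_EFinP/measurable_noise_excess.
have mf2 : measurable_fun setT f2 by exact: measurable_funeM.
have mg k : measurable_fun setT (g k) by exact: measurable_funeM.
have mf3 : measurable_fun setT f3 by exact: ge0_emeasurable_sum.
have pointwise w :
  (lp_norm_pow p (fun l => projection_estimator (observation xi eps theta w)
     (mhat w) l - theta l)%R <= f1 w + f2 w + f3 w)%E.
  have [[k /= /andP[k1 kN] kE] Hmin] := Hsel w.
  have Mm : nested_models N [fset l | l in iota 1 m]%fset.
    by exists m => //=; rewrite m1 mN.
  have := Hmin _ Mm; rewrite -kE /observation.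
  rewrite /pco_criterion !(perm_big _ (perm_nested_model _)) /= => crit.
  rewrite lp_loss_split ?(ltW eps0) //.
  have Hk := noise_power_sum_le_excess p xi w k1.
  have S0 : 0 < sigma p (xi 1%N) `^ p by rewrite powR_gt0.
  have := @pco_oracle_inequality R p eps (sigma p (xi 1%N) `^ p) Cp b
    (noise_excess p xi k w) _ _ theta (fun l => xi l w) k m p0 eps0 S0 Cp0 b0
    (noise_excess_ge0 p xi k w) crit (pco_penalty_ge _ _ _ _ _ hc1 hc2)
    (HCp _ _ m1) Hk Hb.
  move=> /le_trans; apply.
  (* The term of index j in [f3] is the excess at dimension j + 1, so the selected k >= 1
     corresponds to index [k.-1]. *)
  apply: (@le_trans _ _ (f1 w + f2 w + g k.-1 w)%E); last first.
    by apply: leeD => //; apply: (@le_term_nneseries _ (g ^~ w)).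
  rewrite /f1 /f2 /g /cst prednK // -!EFinM -!EFinD lee_fin -/E -/A.
  rewrite /noise_power_sum le_eqVlt; apply/orP; left; apply/eqP; ring.
rewrite /lp_risk.
apply: (@le_trans _ _ (\int[P]_w (f1 w + f2 w + f3 w))%E).
  apply: le_integral_nneg => // w.
  by apply: nneseries_ge0 => l _ _; rewrite lee_fin powR_ge0.
rewrite ge0_integralD //; last 2 first.
- by move=> w _; rewrite adde_ge0.
- by apply: emeasurable_funD.
rewrite ge0_integralD //.
have I1 : (\int[P]_w f1 w = (A * (E * m%:R + b))%:E)%E.
  rewrite /f1 integral_cst // -[RHS]mule1; congr (_ * _)%E.
  exact: probability_setT.
rewrite I1.
have I2 : (\int[P]_w f2 w <= (A * E * (K * m%:R))%:E)%E.
  rewrite ge0_integralZl_EFin //; last first.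
    by move=> w _; rewrite lee_fin noise_power_sum_ge0.
  rewrite [X in (_ <= X)%E]EFinM; apply: lee_wpmul2l; first by rewrite lee_fin.
  have -> : (\int[P]_w (noise_power_sum p xi m w)%:E =
      \int[P]_w \sum_(1 <= l < m.+1) (`|xi l w| `^ p)%:E)%E.
    by apply: eq_integral => w _; rewrite sumEFin.
  rewrite ge0_integral_sum //; last first.
    by move=> l; apply/measurable_EFinP; exact: measurable_noise_power.
  apply: (@le_trans _ _ (\sum_(1 <= l < m.+1) K%:E)%E).
    rewrite big_seq [X in (_ <= X)%E]big_seq; apply: lee_sum => l.
    rewrite mem_index_iota => /andP[l1 _]; apply: HK.
    by case: hxi => _ _ _; exact.
  by rewrite sumEFin sumr_const_nat subn1 /= -[K *+ _]mulr_natr.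
have I3 : (\int[P]_w f3 w <= (A * E * G)%:E)%E.
  rewrite integral_nneseries //.
  under eq_eseriesr => k _.
    rewrite ge0_integralZl_EFin //; last first.
      by move=> w _; rewrite lee_fin noise_excess_ge0.
    over.
  rewrite nneseriesZl; last first.
    by move=> k _; apply: integral_ge0 => w _; rewrite lee_fin noise_excess_ge0.
  by rewrite [X in (_ <= X)%E]EFinM; apply: lee_wpmul2l => //; rewrite lee_fin.
apply: (le_trans (leeD (leeD (lexx _) I2) I3)).
rewrite -!EFinD lee_fin.
have M1 : 1 <= m%:R :> R by rewrite ler1n.
have AG0 := mulr_ge0 AE0 G0; have AK0 := mulr_ge0 AE0 K0.
(* As m >= 1, the O(eps^p) cost of the excesses is absorbed into eps^p m. *)
have AGM : A * E * G <= A * E * G * m%:R by rewrite ler_peMr.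
have AbK : 0 <= A * b * (K + G) := mulr_ge0 (mulr_ge0 A0 b0) (addr_ge0 K0 G0).
apply: (le_trans (lerD (lexx _) AGM)).
rewrite -subr_ge0 [X in 0 <= X](_ : _ = A * b * (K + G)) //; ring.
Qed.

(** Balancing eps^p m against m^(-ps) gives m of order eps^(-t) with t = p/(1 + ps); both terms then
    have the order eps^rate, since rate = p - t = t p s. *)
Lemma besov_rate (R : realType) (p s r : R) : 1 <= p -> 0 < s -> 0 < r ->
  exists2 C : R, 0 <= C & forall (eps : R) (N : nat),
    0 < eps -> eps <= 1 -> (1 <= N)%N -> r `^ p * eps `^ (- p) <= N%:R ->
    exists2 m : nat, (1 <= m <= N)%N &
      eps `^ p * m%:R + r `^ p * m%:R `^ (- (p * s)) <=
        C * eps `^ (p ^+ 2 * s / (1 + p * s)).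
Proof.
move=> p1 s0 r0; have p0 : 0 < p := lt_le_trans ltr01 p1.
have ps0 : 0 < p * s by rewrite mulr_gt0.
have q0 : 0 < 1 + p * s by rewrite addr_gt0.
set t := p / (1 + p * s); set rate := p ^+ 2 * s / (1 + p * s).
have t0 : 0 < t by rewrite divr_gt0.
have rateE1 : rate = p - t by rewrite /rate /t; field; rewrite gt_eqF.
have rateE2 : rate = t * (p * s) by rewrite /rate /t; field; rewrite gt_eqF.
set c := (r `^ p) `^ (- (p * s)).
exists (2 + r `^ p * (1 + c)).
  by rewrite addr_ge0 // mulr_ge0 ?powR_ge0 // addr_ge0 // powR_ge0.
move=> eps N eps0 eps1 N1 HN.
have eps01 : 0 < eps <= 1 by rewrite eps0.
have antitone (x y : R) : 0 < x -> x <= y -> y `^ (- (p * s)) <= x `^ (- (p * s)).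
  move=> x0 xy; have y0 := lt_le_trans x0 xy.
  rewrite !powRN lef_pV2 ?posrE ?powR_gt0 //.
  by apply: le_powR_nneg => //; exact: ltW.
have rate0 : 0 <= eps `^ rate := powR_ge0 _ _.
set D := eps `^ (- t).
have D0 : 0 < D by rewrite powR_gt0.
have D1 : 1 <= D.
  by rewrite /D -[X in X <= _](powRr0 eps); apply: ger_powR => //; rewrite oppr_le0 ltW.
(* Because D >= 1, rounding up in this way gives D < n <= 2 D. *)
set n := (Num.truncn D).+1.
have /andP[nD Dn] : (Num.truncn D)%:R <= D < n%:R by apply: truncn_itv; exact: ltW.
have n2D : n%:R <= 2 * D.
  by rewrite /n -natr1; lra.
have Hn : n%:R `^ (- (p * s)) <= eps `^ rate.
  apply: (le_trans (antitone _ _ D0 (ltW Dn))).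
  by rewrite /D -powRrM mulrNN -rateE2.
have HN' : N%:R `^ (- (p * s)) <= c * eps `^ rate.
  apply: (le_trans (antitone _ _ _ HN)); first by rewrite mulr_gt0 ?powR_gt0.
  rewrite powRM ?powR_ge0 // -/c ler_wpM2l ?powR_ge0 // -powRrM mulrNN rateE2.
  apply: ger_powR => //; rewrite ler_wpM2r ?(ltW ps0) //.
  by rewrite /t ler_pdivrMr // ler_peMr ?(ltW p0) // lerDl ltW.
have Hvar (m : nat) : (m <= n)%N -> eps `^ p * m%:R <= 2 * eps `^ rate.
  move=> mn; apply: (@le_trans _ _ (eps `^ p * (2 * D))).
    by rewrite ler_wpM2l ?powR_ge0 // (le_trans _ n2D) // ler_nat.
  rewrite mulrCA ler_wpM2l // /D -powRD; last by rewrite (gt_eqF eps0) implybT.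
  by rewrite rateE1.
have c0 : 0 <= c := powR_ge0 _ _.
have rp0 : 0 <= r `^ p := powR_ge0 _ _.
exists (minn N n); first by rewrite geq_minl leq_min N1.
rewrite mulrDl; apply: lerD; first by apply: Hvar; exact: geq_minr.
rewrite -mulrA ler_wpM2l // mulrDl mul1r.
have cr0 : 0 <= c * eps `^ rate by rewrite mulr_ge0.
case: (leqP N n) => _; first by rewrite (le_trans HN') // lerDr.
by rewrite (le_trans Hn) // lerDl.
Qed.

Theorem mainTheorem6 (R : realType) (d : measure_display)
    (T : measurableType d) (P : probability T R) (xi : nat -> {RV P >-> R})
    (p s r a c1 c2 : R)
    (hp : 1 <= p) (hs : 0 < s) (hr : 0 < r)
    (ha : 1 + pos_part (1 - p / 2) < a)
    (hxi : subgaussian_noise [set l : nat | (1 <= l)%N] xi)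
    (hsigma : 0 < sigma p (xi 1%N))
    (hc1 : 0 < c1) (hc2 : 0 < c2)
    (hc : concentration_constants p c1 c2) :
  exists C : R, forall (eps : R) (N : nat),
    0 < eps -> eps <= 1 -> (1 <= N)%N -> r `^ p * eps `^ (- p) <= N%:R ->
    forall mhat : (nat -> R) -> T -> {fset nat},
      (forall theta, besov_ball p s r theta ->
         pco_selection p (nested_models N)
           (pco_penalty p a c1 c2 (sigma p (xi 1%N)) eps)
           (observation xi eps theta) (mhat theta)) ->
      (ereal_sup
         [set lp_risk P p
                (fun w => projection_estimator (observation xi eps theta w)
                            (mhat theta w)) theta
           | theta in besov_ball p s r]
       <= (C * r `^ (p / (1 + p * s)) * eps `^ (p ^+ 2 * s / (1 + p * s)))%:E)%E.
Proof.
have a0 : 0 < a.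
  by apply: lt_trans ha; rewrite ltr_pwDl // le_max lexx orbT.
have [A A0 HA] := pco_risk_le hp a0 hxi hsigma hc1 hc2 hc.
have [C C0 HC] := besov_rate hp hs hr.
have p0 : 0 < p := lt_le_trans ltr01 hp.
(* [A] and [C] may depend on r, so the power of r in the statement is compensated in the constant,
   which remains free of eps and N. *)
exists (A * C / r `^ (p / (1 + p * s))).
move=> eps N eps0 eps1 N1 HN mhat Hsel.
rewrite divfK ?gt_eqF ?powR_gt0 //.
apply: ge_ereal_sup => _ [theta Hb <-].
have [m Hm Hrate] := HC eps N eps0 eps1 N1 HN.
have m1 : (0 < m)%N by case/andP: Hm.
have b0 : 0 <= r `^ p * m%:R `^ (- (p * s)) by rewrite mulr_ge0 ?powR_ge0.
apply: le_trans (HA eps N m theta _ _ eps0 Hm b0 (Hsel _ Hb)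
  (besov_ball_tail p0 hr m1 Hb)) _.
by rewrite lee_fin -mulrA ler_wpM2l.
Qed.
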